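(* Let $n,m\ge1$ be integers. Among all choices of breakpoints $0=x_0<x_1<\dots<x_n=1$ and $0=y_0<y_1<\dots<y_m=1$, the uniform spacing $x_k=k/n$ ($k=0,\dots,n$), $y_l=l/m$ ($l=0,\dots,m$) minimizes the average error width $$\mathcal E^{\mathrm{avg}}\Bigl(\bigcup_{k=1}^n\bigcup_{l=1}^m\mathcal M([x_{k-1},x_k],[y_{l-1},y_l]),\ \operatorname{gra}_{[0,1]^2}(xy)\Bigr)$$ over all piecewise McCormick relaxations of $\operatorname{gra}_{[0,1]^2}(xy)$.
   Context: For intervals $[\underline x,\overline x]$ and $[\underline y,\overline y]$, the McCormick envelope $\mathcal M([\underline x,\overline x],[\underline y,\overline y])$ is the set of $(x,y,z)\in[\underline x,\overline x]\times[\underline y,\overline y]\times\mathbb R$ with $\underline x y+x\underline y-\underline x\,\underline y\le z\le \overline x y+x\underline y-\overline x\,\underline y$ and $\overline x y+x\overline y-\overline x\,\overline y\le z\le \underline x y+x\overline y-\underline x\,\overline y$. Given breakpoints $0=x_0<\dots<x_n=1$ and $0=y_0<\dots<y_m=1$, the associated piecewise McCormick relaxation of $\operatorname{gra}_{[0,1]^2}(xy)=\{(x,y,z)\in[0,1]^2\times\mathbb R: z=xy\}$ is $\bigcup_{k=1}^n\bigcup_{l=1}^m\mathcal M([x_{k-1},x_k],[y_{l-1},y_l])$. The average error width $\mathcal E^{\mathrm{avg}}(S,U)$ of a relaxation $S\subseteq\mathbb R^3$ of $U$ (with $U\subseteq S$) is the three-dimensional volume (Lebesgue measure) of $S\setminus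 U$. *)

(* Defs.v *)
(* Points of R^3 are nested pairs (x, y, z) : R * R * R. *)
From HB Require Import structures.
From mathcomp Require Import all_boot all_order all_algebra.
From mathcomp Require Import all_classical all_reals all_analysis.

Set Implicit Arguments.
Unset Strict Implicit.
Unset Printing Implicit Defensive.

Import Order.TTheory GRing.Theory Num.Theory.
Import numFieldNormedType.Exports.

Local Open Scope classical_set_scope.
Local Open Scope ring_scope.

Definition mccormick (R : realType) (xl xu yl yu : R) : set (R * R * R) :=
  [set p | let: (x, y, z) := p in
    [/\ xl <= x <= xu,
        yl <= y <= yu,
        xl * y + x * yl - xl * yl <= z <= xu * y + x * yl - xu * yl &
        xu * y + x * yu - xu * yu <= z <= xl * y + x * yu - xl * yu]].

Definition gra_mul (R : realType) : set (R * R * R) :=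
  [set p | let: (x, y, z) := p in
    [/\ 0 <= x <= 1, 0 <= y <= 1 & z = x * y]].
Arguments gra_mul R : clear implicits.

(* Only the values x 0, ..., x n matter. *)
Definition breakpoints (R : realType) (n : nat) (x : nat -> R) : Prop :=
  [/\ x 0%N = 0, x n = 1 & forall k, (k < n)%N -> x k < x k.+1].

Definition uniform_spacing (R : realType) (n : nat) : nat -> R :=
  fun k => k%:R / n%:R.
Arguments uniform_spacing R n k : clear implicits.

(* The indices k, l run from 0 here, so that the (k, l) piece lives on
   [x k, x (k+1)] * [y l, y (l+1)]. *)
Definition pw_mccormick (R : realType) (n m : nat) (x y : nat -> R) :
    set (R * R * R) :=
  \bigcup_(k in `I_n) \bigcup_(l in `I_m)
    mccormick (x k) (x k.+1) (y l) (y l.+1).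

Definition volume3 (R : realType) (A : set (R * R * R)) : \bar R :=
  ((@lebesgue_measure R \x @lebesgue_measure R) \x @lebesgue_measure R)%E A.

(* Meaningful when U `<=` S. *)
Definition avg_error (R : realType) (S U : set (R * R * R)) : \bar R :=
  volume3 (S `\` U).

(* Main.v *)
(* Over the interior of a cell of size w * h, at horizontal distances u, w - u
   and vertical distances v, h - v from its sides, the envelope exceeds the
   surface z = xy by min((w - u) v, u (h - v)) above and by
   min(u v, (w - u)(h - v)) below.  Integrating over v and then over u, the cell
   has volume w^2 h^2 / 6.  Distinct cells overlap in null sets and the surface
   is null, so the error is (sum_k w_k^2) (sum_l h_l^2) / 6, and each factor is
   minimal for equal steps by Cauchy-Schwarz. *)
Require Import Defs.
From mathcomp Require Import all_boot all_order all_algebra.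
From mathcomp Require Import all_classical all_reals all_analysis.
From mathcomp Require Import measurable_realfun.
From mathcomp Require Import ring lra.
Import Order.TTheory GRing.Theory Num.Theory.
Import numFieldNormedType.Exports.
Local Open Scope classical_set_scope.
Local Open Scope ring_scope.
Set Implicit Arguments.
Unset Strict Implicit.
Unset Printing Implicit Defensive.

(** * Integration of piecewise quadratic functions of one variable *)

Lemma integral_quadratic (R : realType) (F : R -> \bar R) (a b p q r : R)
    (b0 b1 : bool) :
  a < b -> measurable_fun setT F ->
  (forall t, a < t < b -> F t = (p + q * t + r * t ^+ 2)%:E) ->
  (\int[lebesgue_measure]_(t in [set` Interval (BSide b0 a) (BSide b1 b)]) F t
   = (p * (b - a) + q * (b ^+ 2 - a ^+ 2) / 2 + r * (b ^+ 3 - a ^+ 3) / 3)%:E)%E.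
Proof.
move=> ab mF Fpoly.
pose Q : {poly R} := p *: 'X + (q / 2) *: 'X^2 + (r / 3) *: 'X^3.
have dQ t : (deriv Q).[t] = p + q * t + r * t ^+ 2.
  by rewrite /Q !poly.derivE !hornerE /=; field.
(* [F] is only known strictly between [a] and [b], so the null endpoints are dropped before passing
   to the polynomial. They are restored afterwards, because the fundamental theorem is applied on
   the closed interval. *)
rewrite integral_itv_bndoo; last exact: measurable_funTS.
transitivity (\int[lebesgue_measure]_(t in `]a, b[) ((deriv Q).[t])%:E)%E.
  by apply: eq_integral => t; rewrite inE/= in_itv/= => /Fpoly ->; rewrite dQ.
have cQ' := @continuous_horner R (deriv Q).
rewrite -(integral_itv_bndoo true false); last first.
  apply/measurable_EFinP; apply: measurable_funTS.
  exact: continuous_measurable_fun cQ'.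
rewrite (@continuous_FTC2 _ _ (horner Q) a b)//.
- by rewrite -EFinB; congr EFin; rewrite /Q !hornerE /=; field.
- exact: continuous_subspaceT.
- split.
  + by move=> t _; exact: derivable_horner.
  + exact/cvg_at_right_filter/continuous_horner.
  + exact/cvg_at_left_filter/continuous_horner.
- by move=> t _; rewrite derivE.
Qed.

(** * Breakpoints and their step lengths *)

Lemma sum_sqr_steps (R : realFieldType) (n : nat) (x : nat -> R) :
  (0 < n)%N -> x 0%N = 0 -> x n = 1 ->
  n%:R^-1 <= \sum_(k < n) (x k.+1 - x k) ^+ 2.
Proof.
move=> n0 x0 xn.
have nn0 : n%:R != 0 :> R by rewrite pnatr_eq0 -lt0n.
have sw : \sum_(k < n) (x k.+1 - x k) = 1.
  rewrite -(big_mkord xpredT (fun k => x k.+1 - x k)) telescope_sumr//.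
  by rewrite xn x0 subr0.
rewrite -subr_ge0.
(* Cauchy-Schwarz in variance form: the steps sum to 1, so their mean is [n%:R^-1], and the excess
   is the sum of squared deviations from it. *)
have -> : \sum_(k < n) (x k.+1 - x k) ^+ 2 - n%:R^-1 =
    \sum_(k < n) (x k.+1 - x k - n%:R^-1) ^+ 2.
  under [RHS]eq_bigr do rewrite sqrrB -mulrnAr.
  rewrite big_split sumrB /= -mulr_suml sw sumr_const card_ord -[in RHS]mulr_natl.
  by field.
by apply: sumr_ge0 => k _; exact: sqr_ge0.
Qed.

Lemma breakpoints_uniform (R : realType) (n : nat) :
  (0 < n)%N -> breakpoints n (uniform_spacing R n).
Proof.
move=> n0; split; rewrite /uniform_spacing ?mul0r ?divff ?pnatr_eq0 -?lt0n//.
by move=> k _; rewrite ltr_pM2r ?invr_gt0 ?ltr0n// ltr_nat.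
Qed.

Lemma uniform_step (R : realType) (n k : nat) :
  uniform_spacing R n k.+1 - uniform_spacing R n k = n%:R^-1.
Proof. by rewrite /uniform_spacing -mulrBl -natrB// subSnn mul1r. Qed.

Lemma breakpoints_le (R : realType) (n : nat) (x : nat -> R) (i j : nat) :
  breakpoints n x -> (i <= j <= n)%N -> x i <= x j.
Proof.
move=> [_ _ xS]; elim: j => [|j IH] /andP[].
  by rewrite leqn0 => /eqP ->.
rewrite leq_eqVlt => /predU1P[-> //|ij jn].
by apply: le_trans (ltW (xS _ jn)); apply: IH; rewrite -ltnS ij ltnW.
Qed.

(** * Tent functions on an interval *)

Lemma measurable_minr_tent (R : realType) (c d p q : R) :
  measurable_fun [set: R]
    (fun y : R => (Num.min (p * (y - c)) (q * (d - y)))%:E).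
Proof.
apply/measurable_EFinP/measurable_minr.
- apply: measurable_funM; first exact: measurable_cst.
  by apply: measurable_funB => //; exact: measurable_cst.
- apply: measurable_funM; first exact: measurable_cst.
  by apply: measurable_funB => //; exact: measurable_cst.
Qed.

(** The region under the tent is a triangle with base [d - c] and height
    [p * q * (d - c) / (p + q)]. *)
Lemma integral_tent (R : realType) (c d p q : R) : c < d -> 0 < p -> 0 < q ->
  (\int[lebesgue_measure]_(y in `]c, d[) (Num.min (p * (y - c)) (q * (d - y)))%:E
   = (p * q * (d - c) ^+ 2 / (2 * (p + q)))%:E)%E.
Proof.
move=> cd p0 q0; have pq0 : 0 < p + q by rewrite addr_gt0.
(* The apex, where [p * (t - c) = q * (d - t)]; the minimum is the rising line before it and the
   falling line after it. *)
pose t := (p * c + q * d) / (p + q).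
have tE : t * (p + q) = p * c + q * d by rewrite /t divfK// gt_eqF.
have ct : c < t by rewrite /t ltr_pdivlMr//; nra.
have td : t < d by rewrite /t ltr_pdivrMr//; nra.
have mf := measurable_minr_tent c d p q.
rewrite (@itv_bndbnd_setU _ _ (BRight c) (BRight t) (BLeft d))/= ?bnd_simp// 1?ltW//.
rewrite ge0_integral_setU//=; last 3 first.
- exact: measurable_funTS.
- move=> y /= H; rewrite lee_fin le_min !mulr_ge0 ?subr_ge0 ?(ltW p0) ?(ltW q0)//.
    by case: H => /=; rewrite in_itv/= => /andP[? ?]; lra.
  by case: H => /=; rewrite in_itv/= => /andP[? ?]; lra.
- apply/disj_setPS => y [/=]; rewrite !in_itv/= => /andP[_ ?] /andP[? _]; lra.
rewrite (@integral_quadratic _ _ c t (- p * c) p 0)//; last first.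
  move=> y /andP[cy yt]; congr EFin; rewrite min_l; first by ring.
  by nra.
rewrite (@integral_quadratic _ _ t d (q * d) (- q) 0)//; last first.
  move=> y /andP[ty yd]; congr EFin; rewrite min_r; first by ring.
  by nra.
rewrite -EFinD; congr EFin; rewrite /t; field.
by rewrite gt_eqF.
Qed.

(** * Volume of a cell from the lengths of its vertical fibres *)

Lemma integral_itv_support (R : realType) (F : R -> \bar R) (a b : R) :
  measurable_fun [set: R] F -> (forall t, ~ (a <= t <= b) -> F t = 0%E) ->
  (\int[lebesgue_measure]_t F t = \int[lebesgue_measure]_(t in `]a, b[) F t)%E.
Proof.
move=> mF F0; rewrite -(integral_itv_bndoo true false); last exact: measurable_funTS.
rewrite [RHS]integral_mkcond; apply: eq_integral => t _.
rewrite patchE; case: ifPn => // /negP tab; apply: F0 => atb; apply: tab.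
by rewrite inE/= in_itv.
Qed.

(* Both the closed envelope and its open version without the surface satisfy
   these hypotheses: sections over the boundary of the cell are unconstrained. *)
Lemma volume3_cell (R : realType) (a b c d : R) (A : set (R * R * R)) :
  a < b -> c < d -> measurable A ->
  (forall x y z, A (x, y, z) -> a <= x <= b /\ c <= y <= d) ->
  (forall x y, a < x < b -> c < y < d ->
    lebesgue_measure (xsection A (x, y)) =
    (Num.min ((b - x) * (y - c)) ((x - a) * (d - y)) +
     Num.min ((x - a) * (y - c)) ((b - x) * (d - y)))%:E) ->
  volume3 A = ((b - a) ^+ 2 * (d - c) ^+ 2 / 6)%:E.
Proof.
move=> ab cd mA Abox Asec.
pose f (p : R * R) := lebesgue_measure (xsection A p).
have mf : measurable_fun [set: R * R] f.
  exact: (measurable_fun_xsection (@lebesgue_measure R) mA).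
have f_ge0 p : (0 <= f p)%E by exact: measure_ge0.
have f0 x y : ~ (a <= x <= b /\ c <= y <= d) -> f (x, y) = 0%E.
  move=> xyN; rewrite /f (_ : xsection A (x, y) = set0) ?measure0//.
  by apply/seteqP; split => // z /xsectionP /Abox.
(* Tonelli: fibre lengths are integrated over [y] first, then over [x]. *)
transitivity (\int[@lebesgue_measure R]_x fubini_F (@lebesgue_measure R) f x)%E.
  exact: (@fubini_tonelli1 _ _ _ _ R
    (@lebesgue_measure R) (@lebesgue_measure R) f mf f_ge0).
have mF := measurable_fun_fubini_tonelli_F (m2 := @lebesgue_measure R) f mf f_ge0.
rewrite (@integral_itv_support _ _ a b mF); last first.
  move=> x xN; rewrite /fubini_F; apply: integral0_eq => y _.
  by apply: f0 => -[].
(* For fixed [x] both tents in [y] have slopes [b - x] and [x - a], in opposite orders, with sum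
   [b - a]. Together they integrate to [(x - a) * (b - x) * (d - c) ^+ 2 / (b - a)], whose expansion
   in [x] gives these coefficients. *)
rewrite (@integral_quadratic _ _ a b (- a * b * (d - c) ^+ 2 / (b - a))
  ((a + b) * (d - c) ^+ 2 / (b - a)) (- (d - c) ^+ 2 / (b - a)))//.
  by congr EFin; field; rewrite subr_eq0 gt_eqF.
move=> x /andP[ax xb]; rewrite /fubini_F.
rewrite (@integral_itv_support _ _ c d); last 2 first.
- exact: measurableT_comp.
- by move=> y yN; apply: f0 => -[].
transitivity (\int[lebesgue_measure]_(y in `]c, d[)
    ((Num.min ((b - x) * (y - c)) ((x - a) * (d - y)))%:E +
     (Num.min ((x - a) * (y - c)) ((b - x) * (d - y)))%:E))%E.
  apply: eq_integral => y; rewrite inE/= in_itv/= => yin.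
  by rewrite /f Asec ?ax.
rewrite ge0_integralD//=; last 4 first.
- move=> y /=; rewrite in_itv/= => /andP[? ?].
  by rewrite lee_fin le_min; apply/andP; split; apply: mulr_ge0; lra.
- by apply: measurable_funTS; exact: measurable_minr_tent.
- move=> y /=; rewrite in_itv/= => /andP[? ?].
  by rewrite lee_fin le_min; apply/andP; split; apply: mulr_ge0; lra.
- by apply: measurable_funTS; exact: measurable_minr_tent.
rewrite !integral_tent ?subr_gt0// -EFinD; congr EFin; field.
by rewrite subr_eq0 gt_eqF// andbT gt_eqF//; lra.
Qed.

(** * Measurability of the envelope, separation of the cells *)

Lemma measurable_mccormick (R : realType) (a b c d : R) :
  measurable (mccormick a b c d).
Proof.
have mle (f g : R * R * R -> R) : measurable_fun [set: R * R * R] f ->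
    measurable_fun [set: R * R * R] g -> measurable [set p | f p <= g p].
  move=> mf mg; have mfg : measurable_fun [set: R * R * R] (fun p => f p <= g p).
    exact: measurable_fun_ler.
  have := mfg measurableT [set true] I.
  by rewrite setTI.
pose X (p : R * R * R) := p.1.1; pose Y (p : R * R * R) := p.1.2.
pose Z (p : R * R * R) := p.2.
have mX : measurable_fun [set: R * R * R] X.
  exact: (measurableT_comp measurable_fst measurable_fst).
have mY : measurable_fun [set: R * R * R] Y.
  exact: (measurableT_comp measurable_snd measurable_fst).
have mZ : measurable_fun [set: R * R * R] Z by exact: measurable_snd.
have maff (s t u : R) : measurable_fun [set: R * R * R]
    (fun p : R * R * R => s * Y p + X p * t - u).
  apply: measurable_funB => //; apply: measurable_funD.
    by apply: measurable_funM.
  by apply: measurable_funM.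
rewrite (_ : mccormick a b c d =
  [set p | a <= X p] `&` [set p | X p <= b] `&`
  ([set p | c <= Y p] `&` [set p | Y p <= d]) `&`
  ([set p | a * Y p + X p * c - a * c <= Z p] `&`
   [set p | Z p <= b * Y p + X p * c - b * c]) `&`
  ([set p | b * Y p + X p * d - b * d <= Z p] `&`
   [set p | Z p <= a * Y p + X p * d - a * d])).
  by do ![apply: measurableI]; apply: mle.
apply/seteqP; split => -[[x y] z] /=.
  by move=> [/andP[? ?] /andP[? ?] /andP[? ?] /andP[? ?]]; do !split.
by move=> [[[[? ?] [? ?]] [? ?]] [? ?]]; split; apply/andP.
Qed.

(** Used for the disjointness of the open cells: if [i < j], the breakpoint [x i.+1] is at most
    [x j] and separates the two intervals. *)
Lemma breakpoints_cell_inj (R : realType) (n : nat) (x : nat -> R) (i j : nat)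
    (t : R) :
  breakpoints n x -> (i < n)%N -> (j < n)%N ->
  x i < t < x i.+1 -> x j < t < x j.+1 -> i = j.
Proof.
move=> bx; wlog ij : i j / (i < j)%N.
  move=> H i_n j_n ti tj; case: (ltngtP i j) => // ij; first exact: H ij _ _ _ _.
  by apply/esym; exact: H ij _ _ _ _.
move=> _ jn /andP[_ ti] /andP[tj _].
have : x i.+1 <= x j by apply: (breakpoints_le bx); rewrite ij ltnW.
by move=> xij; exfalso; lra.
Qed.

(** * The surface and the open cells *)

Definition surface_mul (R : realType) : set (R * R * R) :=
  [set p | p.2 = p.1.1 * p.1.2].
Arguments surface_mul R : clear implicits.

(** The open base makes distinct cells disjoint; removing the surface keeps each cell of the
    partition inside the error set. *)
Definition open_cell (R : realType) (a b c d : R) : set (R * R * R) :=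
  mccormick a b c d `&` ((`]a, b[ `*` `]c, d[) `*` setT) `\` surface_mul R.

Lemma measurable_surface_mul (R : realType) : measurable (surface_mul R).
Proof.
have mE : measurable_fun [set: R * R * R]
    (fun p : R * R * R => p.2 == p.1.1 * p.1.2).
  apply: measurable_fun_eqr; first exact: measurable_snd.
  apply: measurable_funM.
    exact: (measurableT_comp measurable_fst measurable_fst).
  exact: (measurableT_comp measurable_snd measurable_fst).
have := mE measurableT [set true] I.
rewrite setTI (_ : _ @^-1` _ = surface_mul R)//.
by apply/seteqP; split => p /=; [move/eqP|move=> ->; rewrite eqxx].
Qed.

Lemma measurable_box (R : realType) (i j : interval R) :
  measurable (([set` i] `*` [set` j]) `*` setT : set (R * R * R)).
Proof. by apply: measurableX => //; apply: measurableX. Qed.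

Lemma gra_mulE (R : realType) :
  gra_mul R = ((`[0, 1] `*` `[0, 1]) `*` setT) `&` surface_mul R.
Proof.
apply/seteqP; split => -[[x y] z] /=; rewrite !in_itv/=; first by case.
by case=> -[[]].
Qed.

Lemma measurable_gra_mul (R : realType) : measurable (gra_mul R).
Proof.
rewrite gra_mulE; apply: measurableI; first exact: measurable_box.
exact: measurable_surface_mul.
Qed.

Lemma measurable_open_cell (R : realType) (a b c d : R) :
  measurable (open_cell a b c d).
Proof.
apply: measurableD; last exact: measurable_surface_mul.
apply: measurableI; last exact: measurable_box.
exact: measurable_mccormick.
Qed.

(** * Fibre lengths and cell volumes *)

Lemma xsection_mccormick (R : realType) (a b c d x y : R) :
  a < x < b -> c < y < d ->
  xsection (mccormick a b c d) (x, y) =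
  `[x * y - Num.min ((x - a) * (y - c)) ((b - x) * (d - y)),
    x * y + Num.min ((b - x) * (y - c)) ((x - a) * (d - y))]%classic.
Proof.
move=> /andP[ax xb] /andP[cy yd].
(* Each bounding plane differs from [x * y] by a product of distances to two sides, for instance [a
   * y + x * c - a * c = x * y - (x - a) * (y - c)]. The larger lower plane thus subtracts a
   minimum, and the smaller upper plane adds one. *)
rewrite oppr_min addr_maxr addr_minr; apply/seteqP; split=> z /=.
  move=> /xsectionP[_ _ /andP[z1 z2] /andP[z3 z4]].
  by rewrite in_itv/= ge_max le_min; apply/andP; split; apply/andP; split; lra.
rewrite in_itv/= ge_max le_min => /andP[/andP[z1 z2] /andP[z3 z4]].
by apply/xsectionP; split; apply/andP; split; lra.
Qed.

Lemma measure_xsection_mccormick (R : realType) (a b c d x y : R) :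
  a < x < b -> c < y < d ->
  lebesgue_measure (xsection (mccormick a b c d) (x, y)) =
    (Num.min ((b - x) * (y - c)) ((x - a) * (d - y)) +
     Num.min ((x - a) * (y - c)) ((b - x) * (d - y)))%:E.
Proof.
move=> axb cyd; rewrite xsection_mccormick// lebesgue_measure_itv/= lte_fin.
move: axb cyd => /andP[ax xb] /andP[cy yd].
set m1 := Num.min _ _; set m2 := Num.min _ _.
have m1_gt0 : 0 < m1 by rewrite lt_min !mulr_gt0 ?subr_gt0.
have m2_gt0 : 0 < m2 by rewrite lt_min !mulr_gt0 ?subr_gt0.
rewrite ifT; last by lra.
by rewrite -EFinB; congr EFin; ring.
Qed.

Lemma measure_xsection_open_cell (R : realType) (a b c d x y : R) :
  a < x < b -> c < y < d ->
  lebesgue_measure (xsection (open_cell a b c d) (x, y)) =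
    (Num.min ((b - x) * (y - c)) ((x - a) * (d - y)) +
     Num.min ((x - a) * (y - c)) ((b - x) * (d - y)))%:E.
Proof.
move=> axb cyd; rewrite -measure_xsection_mccormick//.
(* The surface meets a fibre in the single point [x * y], which is null. *)
have -> : xsection (open_cell a b c d) (x, y) =
    xsection (mccormick a b c d) (x, y) `\` [set x * y].
  apply/seteqP; split=> z.
    by move=> /xsectionP[[Mz _] zxy]; split; [apply/xsectionP|].
  by move=> [/xsectionP Mz zxy]; apply/xsectionP; split => //; split => //.
have mM := measurable_xsection (x, y) (measurable_mccormick a b c d).
rewrite measureD//=; last by rewrite measure_xsection_mccormick// ltry.
rewrite [X in (_ - X)%E](_ : _ = 0%E) ?sube0//.
apply/eqP; rewrite -measure_le0 -(lebesgue_measure_set1 (x * y)).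
by apply: le_measure; rewrite ?inE//; exact: measurableI.
Qed.

Lemma volume3_mccormick (R : realType) (a b c d : R) : a < b -> c < d ->
  volume3 (mccormick a b c d) = ((b - a) ^+ 2 * (d - c) ^+ 2 / 6)%:E.
Proof.
move=> ab cd; apply: volume3_cell => //.
- exact: measurable_mccormick.
- by move=> x y z [].
- by move=> x y; exact: measure_xsection_mccormick.
Qed.

Lemma volume3_open_cell (R : realType) (a b c d : R) : a < b -> c < d ->
  volume3 (open_cell a b c d) = ((b - a) ^+ 2 * (d - c) ^+ 2 / 6)%:E.
Proof.
move=> ab cd; apply: volume3_cell => //.
- exact: measurable_open_cell.
- by move=> x y z [[[]]].
- by move=> x y; exact: measure_xsection_open_cell.
Qed.

(** * The error as a sum over cells, and its minimum *)

Lemma avg_error_pw_mccormick (R : realType) (n m : nat) (x y : nat -> R) :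
  breakpoints n x -> breakpoints m y ->
  avg_error (pw_mccormick n m x y) (gra_mul R) =
  ((\sum_(k < n) (x k.+1 - x k) ^+ 2) *
   (\sum_(l < m) (y l.+1 - y l) ^+ 2) / 6)%:E.
Proof.
move=> bx by_; have [_ _ xS] := bx; have [_ _ yS] := by_.
(* [mu] is [volume3] bundled as a measure, so that additivity and subadditivity apply to it. *)
pose L := measurableTypeR R.
pose mu : {measure set (L * L * L) -> \bar R} :=
  ((@lebesgue_measure R \x @lebesgue_measure R) \x @lebesgue_measure R)%E.
have volE A : volume3 A = mu A by [].
pose D := `I_n `*` `I_m.
pose M kl := mccormick (x kl.1) (x kl.1.+1) (y kl.2) (y kl.2.+1).
pose O kl := open_cell (x kl.1) (x kl.1.+1) (y kl.2) (y kl.2.+1).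
pose v (kl : nat * nat) : R :=
  (x kl.1.+1 - x kl.1) ^+ 2 * (y kl.2.+1 - y kl.2) ^+ 2 / 6.
have finD : finite_set D by exact: finite_setX.
have pwE : pw_mccormick n m x y = \bigcup_(kl in D) M kl.
  by rewrite /pw_mccormick -bigcup_setX.
have mM kl : measurable (M kl) by exact: measurable_mccormick.
have mO kl : measurable (O kl) by exact: measurable_open_cell.
have mS : measurable (\bigcup_(kl in D) M kl `\` gra_mul R).
  apply: measurableD; last exact: measurable_gra_mul.
  exact: fin_bigcup_measurable.
have volM : (\sum_(kl \in D) mu (M kl) = \sum_(kl \in D) (v kl)%:E)%E.
  apply: eq_fsbigr => kl /set_mem[/xS ? /yS ?].
  by rewrite -volE volume3_mccormick.
have volO : (\sum_(kl \in D) mu (O kl) = \sum_(kl \in D) (v kl)%:E)%E.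
  apply: eq_fsbigr => kl /set_mem[/xS ? /yS ?].
  by rewrite -volE volume3_open_cell.
have trivO : trivIset D O.
  move=> [k l] [k' l'] [/= kn lm] [/= k'n l'm].
  move=> [[[s t] z] [[[_ [[/= s1 t1] _]] _] [[_ [[/= s2 t2] _]] _]]].
  move: s1 s2 t1 t2; rewrite !in_itv/= => s1 s2 t1 t2.
  by rewrite (breakpoints_cell_inj bx kn k'n s1 s2)
             (breakpoints_cell_inj by_ lm l'm t1 t2).
have -> : (\sum_(k < n) (x k.+1 - x k) ^+ 2) *
    (\sum_(l < m) (y l.+1 - y l) ^+ 2) / 6 = \sum_(kl \in D) v kl.
  rewrite (fsbig_ord _ n (fun k => (x k.+1 - x k) ^+ 2)).
  rewrite (fsbig_ord _ m (fun l => (y l.+1 - y l) ^+ 2)).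
  rewrite -(pair_fsbig _ (fun k l =>
    (x k.+1 - x k) ^+ 2 * (y l.+1 - y l) ^+ 2 / 6))//.
  rewrite -!fsbig_ord -mulrA mulr_suml; apply: eq_bigr => k _.
  rewrite -fsbig_ord mulr_suml mulr_sumr; apply: eq_bigr => l _.
  by rewrite mulrA.
(* Upper bound: the closed cells cover.  Lower bound: the open cells without the
   surface are disjoint. *)
rewrite -fsumEFin// /avg_error pwE volE; apply/eqP; rewrite eq_le; apply/andP; split.
  rewrite -volM.
  exact: (content_sub_fsum mu finD (fun kl _ => mM kl) mS (@subDsetl _ _ _)).
have mUO : measurable (\bigcup_(kl in D) O kl) by exact: fin_bigcup_measurable.
rewrite -volO -(measure_fin_bigcup mu finD trivO (fun kl _ => mO kl)).
apply: (le_measure mu (mem_set mUO) (mem_set mS)) => p [kl Dkl [[Mp _] Sp]].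
(* A point off the whole surface is off its part over the unit square. *)
by split; [exists kl|rewrite gra_mulE => -[]].
Qed.

Theorem theorem1 (R : realType) (n m : nat) (hn : (1 <= n)%N) (hm : (1 <= m)%N) :
  breakpoints n (uniform_spacing R n) /\
  breakpoints m (uniform_spacing R m) /\
  forall x y : nat -> R, breakpoints n x -> breakpoints m y ->
    (avg_error (pw_mccormick n m (uniform_spacing R n) (uniform_spacing R m))
               (gra_mul R)
     <= avg_error (pw_mccormick n m x y) (gra_mul R))%E.
Proof.
have bn := breakpoints_uniform R hn; have bm := breakpoints_uniform R hm.
split; first exact: bn.
split; first exact: bm.
move=> x y bx by_; rewrite !avg_error_pw_mccormick// lee_fin.
have uniform_sum k : (0 < k)%N ->
    \sum_(i < k) (uniform_spacing R k i.+1 - uniform_spacing R k i) ^+ 2 = k%:R^-1.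
  move=> k0; under eq_bigr do rewrite uniform_step.
  by rewrite sumr_const card_ord -[LHS]mulr_natl; field; rewrite pnatr_eq0 -lt0n.
rewrite !uniform_sum// ler_pM2r ?invr_gt0 ?ltr0n//.
case: bx by_ => x0 xn _ [y0 ym _].
(* Uniform steps attain both one-dimensional bounds, and these multiply because the inverses of [n]
   and [m] are nonnegative. *)
by apply: ler_pM; rewrite ?invr_ge0 ?ler0n ?sum_sqr_steps.
Qed.
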